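(* Let $G$ be a group. For $j=1,\ldots,n$ let $\sigma_j$ be a splitting of $G$ over $H_j$, and let $X_j$ be an $H_j$-almost invariant set arising from $\sigma_j$. Let $\Sigma=\{gX_j,gX_j^*\mid g\in G,\ j=1,\ldots,n\}$. Assume that $\leq$ is a partial order on $\Sigma$ and that $\{\sigma_1,\ldots,\sigma_n\}$ satisfies sandwiching. Then for all $A,B\in\Sigma$, there are only finitely many $C\in\Sigma$ such that $A\leq C\leq B$.
   Context: For $X\subset G$, $X^*=G\setminus X$, $\Sigma(X)=\{gX,gX^*\mid g\in G\}$, $\mathrm{Stab}(X)=\{g: gX=X\}$. A subset of $G$ is $H$-finite if it is contained in finitely many right cosets $Hg_i$. The corners of a pair $(A,B)$ are $A\cap B$, $A\cap B^*$, $A^*\cap B$, $A^*\cap B^*$. A $G$-tree is a simplicial tree with a simplicial $G$-action that inverts no edge. A splitting of $G$ is a $G$-tree $T$ with no global fixed point such that $G\backslash T$ has exactly one edge; it is over $H$ if $H$ is an edge stabilizer. An $H$-almost invariant set arising from the splitting is a set $X=\{g\in G : e \text{ points away from } gv\}$, where $v$ is a vertex of $T$, $e$ is a directed edge of $T$, and $H=\mathrm{Stab}(e)=\mathrm{Stab}(X)$; ''$e$ points away from $gv$'' means that $gv$ lies in the component of $T$ minus the interior of $e$ containing the initial vertex of $e$. For $A,B\in\Sigma$, a corner of $(A,B)$ is small if it is $\mathrm{Stab}(A)$-finite (equivalently, here, $\mathrm{Stab}(B)$-finite); $A$ crosses $B$ if no corner is small. $A\leq B$ means that $A\cap B^*$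 is empty or is the only small corner of $(A,B)$. (This is a partial order on $\Sigma$ when the $\sigma_j$ are pairwise non-isomorphic.) Sandwiching: $X_j$ is sandwiched by $X_k$ if either there exist $A,B\in\Sigma(X_k)$ with $A\leq X_j\leq B$, or $X_j$ crosses every element of $\Sigma(X_k)$. $\{\sigma_j\}$ satisfies sandwiching if for all $j,k$, $X_j$ is sandwiched by $X_k$ (this does not depend on the choice of the sets $X_j$ arising from $\sigma_j$). *)

(* Defs.v *)
From mathcomp Require Import all_boot.
From mathcomp Require Import mathcomp_extra boolp classical_sets functions.
From mathcomp Require Import cardinality.

Set Implicit Arguments.
Unset Strict Implicit.
Unset Printing Implicit Defensive.

Local Open Scope classical_set_scope.
Local Open Scope group_scope.

Section SubsetsOfGroup.
Variable G : groupType.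
Implicit Types (H X A B C : set G) (g : G) (S : set (set G)).

Definition translate g X : set G := [set g * x | x in X].

Definition stab X : set G := [set g | translate g X = X].

Definition rcoset_of H g : set G := [set h * g | h in H].

Definition finite_mod H X : Prop :=
  exists2 F : set G, finite_set F & X `<=` \bigcup_(g in F) rcoset_of H g.

Definition Sigma X : set (set G) :=
  [set A | exists g, A = translate g X \/ A = translate g (~` X)].

(* For a corner [C] of the ordered pair [(A, B)]; the second set [B] of the
   pair plays no role, smallness being measured with the stabilizer of [A]. *)
Definition small A C : Prop := finite_mod (stab A) C.

Definition crosses A B : Prop :=
  [/\ ~ small A (A `&` B), ~ small A (A `&` ~` B),
      ~ small A (~` A `&` B) & ~ small A (~` A `&` ~` B)].

Definition ai_le A B : Prop :=
  A `&` ~` B = set0 \/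
  [/\ small A (A `&` ~` B), ~ small A (A `&` B),
      ~ small A (~` A `&` B) & ~ small A (~` A `&` ~` B)].

Definition sandwiched X Y : Prop :=
  (exists A B, [/\ Sigma Y A, Sigma Y B, ai_le A X & ai_le X B]) \/
  (forall A, Sigma Y A -> crosses X A).

Definition partial_order_on S (R : set G -> set G -> Prop) : Prop :=
  [/\ forall A, S A -> R A A,
      forall A B, S A -> S B -> R A B -> R B A -> A = B
    & forall A B C, S A -> S B -> S C -> R A B -> R B C -> R A C].

End SubsetsOfGroup.

(* A simplicial tree is given by its vertices and the adjacency relation; a
   directed edge from [x] to [y] is an ordered pair with [tree_adj x y].
   [tree_acyclic] says that there is no simple closed path of length at least
   3; the [p] with [size p = 2] are just edges traversed back and forth. *)
Record gtree (G : groupType) := GTree {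
  vertex :> eqType;
  tree_adj : rel vertex;
  tree_act : G -> vertex -> vertex;
  tree_adj_sym : symmetric tree_adj;
  tree_adj_irr : irreflexive tree_adj;
  tree_nonempty : inhabited vertex;
  tree_connected : forall x y : vertex,
    exists2 p, path tree_adj x p & last x p = y;
  tree_acyclic : forall p : seq vertex, 2 < size p -> ~ ucycle tree_adj p;
  tree_act1 : forall x, tree_act 1 x = x;
  tree_actM : forall g h x, tree_act (g * h) x = tree_act g (tree_act h x);
  tree_act_adj : forall g x y,
    tree_adj (tree_act g x) (tree_act g y) = tree_adj x y;
  tree_no_inversion : forall g x y,
    tree_adj x y -> ~ (tree_act g x = y /\ tree_act g y = x)
}.

Section Splittings.
Variables (G : groupType) (T : gtree G).
Implicit Types (x y v w : T) (H X : set G).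

Definition edge_stab x y : set G :=
  [set g | tree_act g x = x /\ tree_act g y = y].

(* Since no edge is inverted, an element of [G] fixing an interior point of an
   edge fixes both its ends, so global fixed points can be sought among the
   vertices. *)
Definition no_global_fixed_point : Prop :=
  ~ exists v : T, forall g : G, tree_act g v = v.

Definition one_edge_orbit : Prop :=
  (exists x y : T, tree_adj x y) /\
  forall x y x' y' : T, tree_adj x y -> tree_adj x' y' ->
    exists g : G, (tree_act g x = x' /\ tree_act g y = y') \/
                  (tree_act g x = y' /\ tree_act g y = x').

Definition is_splitting : Prop := no_global_fixed_point /\ one_edge_orbit.

Definition splitting_over H : Prop :=
  is_splitting /\ exists x y, tree_adj x y /\ H = edge_stab x y.

Definition adj_minus x y : rel T :=
  [rel a b | [&& tree_adj a b, (a, b) != (x, y) & (a, b) != (y, x)]].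

(* [w] lies in the component, containing the initial vertex [x], of the tree
   minus the interior of the edge from [x] to [y]. *)
Definition points_away x y w : Prop :=
  exists2 p, path (adj_minus x y) x p & last x p = w.

Definition arises_from H X : Prop :=
  exists v x y : T,
    [/\ tree_adj x y,
        X = [set g | points_away x y (tree_act g v)],
        H = edge_stab x y
      & H = stab X].

End Splittings.

Definition sandwiching (G : groupType) (n : nat) (X : 'I_n -> set G) : Prop :=
  forall j k : 'I_n, sandwiched (X j) (X k).

Definition Sigma_family (G : groupType) (n : nat) (X : 'I_n -> set G) :
  set (set G) := \bigcup_(j in [set: 'I_n]) Sigma (X j).

(* Main.v *)
(* Every element of Sigma is a half-space: the set of g such that g v lies on a
   given side of an edge of one of the trees. Three facts about half-spaces
   give the result.
   - A half-space is not finite modulo its stabilizer: a leaf would force a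
     global fixed point, so each side of an edge contains points of the orbit of
     v arbitrarily far from that edge.
   - Hence smallness of a corner does not depend on which of the two
     stabilizers is used, and A <= B implies B* <= A*.
   - Two edges of the same tree always have an empty corner, so for half-spaces
     of the same tree A <= B is just inclusion.
   If some element C of Sigma(X_k) satisfies A <= C <= B, sandwiching and this
   duality give P, Q in Sigma(X_k) with P <= A and B <= Q. Every such C then
   satisfies P <= C <= Q, and its edge separates g v from h v, where g is any
   point of P and h any point outside Q; there are finitely many such edges. *)

Require Import Defs.
From mathcomp Require Import all_boot.
From mathcomp Require Import mathcomp_extra boolp classical_sets functions.
From mathcomp Require Import cardinality.

Local Open Scope classical_set_scope.

(** * Sides of an edge in a tree *)

Section Tree.
Set Implicit Arguments.
Unset Strict Implicit.
Local Open Scope group_scope.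
Variables (G : groupType) (T : gtree G).
Implicit Types (x y a b c u v w z : T) (g h : G).

Lemma adj_minusC x y a b : adj_minus x y a b = adj_minus y x a b.
Proof. by rewrite /adj_minus /= [((a, b) != (x, y)) && _]andbC. Qed.

Lemma adj_minus_sym x y a b : adj_minus x y a b = adj_minus x y b a.
Proof.
rewrite /adj_minus /= tree_adj_sym !xpair_eqE.
by rewrite [(b == x) && _]andbC [(b == y) && _]andbC [(~~ _) && ~~ _]andbC.
Qed.

Lemma adj_minusPn x y a b : tree_adj a b -> ~~ adj_minus x y a b ->
  (a = x /\ b = y) \/ (a = y /\ b = x).
Proof.
rewrite /adj_minus /= => -> /=; rewrite negb_and !negbK => /orP[] /eqP[-> ->].
  by left.
by right.
Qed.

Lemma points_away_refl x y : points_away x y x.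
Proof. by exists [::]. Qed.

Lemma points_away_step x y a b :
  points_away x y a -> adj_minus x y a b -> points_away x y b.
Proof.
move=> [p xp pa] ab; exists (rcons p b); last by rewrite last_rcons.
by rewrite rcons_path xp pa.
Qed.

Lemma points_away_edge x y a b : tree_adj a b -> points_away x y a ->
  ~ points_away x y b -> a = x /\ b = y.
Proof.
move=> ab pa pb; have /(adj_minusPn ab)[//|[_ bx]] : ~~ adj_minus x y a b.
  by apply/negP => /(points_away_step pa).
by case: pb; rewrite bx; exact: points_away_refl.
Qed.

(** The first step of the path that leaves the side of [x] must traverse the removed edge, from [x]
    to [y]. *)
Lemma separating_edge_on_path x y a (p : seq T) : path (@tree_adj G T) a p ->
  points_away x y a -> ~ points_away x y (last a p) ->
  x \in a :: p /\ y \in a :: p.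
Proof.
elim: p a => [|b p IH] a //= /andP[ab bp] pa npl.
have [pb|npb] := pselect (points_away x y b).
  have [xp yp] := IH b bp pb npl.
  by split; rewrite in_cons ?xp ?yp orbT.
have [-> ->] := points_away_edge ab pa npb.
by rewrite !in_cons !eqxx orbT.
Qed.

Lemma points_away_back x y a (p : seq T) : path (adj_minus x y) a p ->
  points_away x y (last a p) -> points_away x y a.
Proof.
elim: p a => [|b p IH] a //= /andP[ab bp] pl.
by apply: points_away_step (IH _ bp pl) _; rewrite adj_minus_sym.
Qed.

Lemma not_points_away x y : tree_adj x y -> ~ points_away x y y.
Proof.
move=> xy [p xp py]; have := xp; move: py; case/shortenP: xp => q xq uq _ qy _.
apply: (@tree_acyclic G T (x :: q)).
  (* The simple path has at least two steps: no step would give [x = y], and a single step would be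
     the removed edge. Closed up by that edge, it is a forbidden cycle. *)
  case: q xq qy {uq} => [|z [|z' q]] //= xz zy.
    by move: xy; rewrite zy tree_adj_irr.
  by move: xz; rewrite zy /adj_minus /= eqxx andbF.
rewrite /ucycle uq andbT /= rcons_path qy tree_adj_sym xy andbT.
by move: xq; apply: sub_path => a b /andP[].
Qed.

Lemma points_awayN x y w : tree_adj x y ->
  points_away y x w <-> ~ points_away x y w.
Proof.
move=> xy; split=> [[p yp pw] xw|].
  apply: (not_points_away xy); apply: (@points_away_back _ _ _ p).
    by rewrite -(eq_path (adj_minusC y x)).
  by rewrite pw.
(* Each step either avoids the edge and stays on its side, or traverses the edge and arrives at an
   end of it. *)
pose side a := points_away x y a \/ points_away y x a.
have walk (p : seq T) a : path (@tree_adj G T) a p -> side a -> side (last a p).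
  elim: p a => [|b p IH] a //= /andP[ab bp] sa; apply: IH => //.
  have [abxy|/(adj_minusPn ab)] := boolP (adj_minus x y a b).
    case: sa => /points_away_step pb; [left|right]; apply: pb => //.
    by rewrite adj_minusC.
  by case=> [] [_ ->]; [right|left]; exact: points_away_refl.
have [p xp <-] := tree_connected x w.
by case: (walk p x xp) => //; left; exact: points_away_refl.
Qed.

Lemma points_away_path x y (p : seq T) z : path (adj_minus x y) x p ->
  z \in x :: p -> points_away x y z.
Proof.
move=> xp zp; case/splitPl: zp xp => p1 p2 <-; rewrite cat_path => /andP[xp1 _].
by exists p1.
Qed.

(** A path from [x] to [w] within the side of [x] never meets [x'], so it cannot cross the edge from
    [x'] to [y']. *)
Lemma side_connected x y x' y' w : tree_adj x' y' ->
  ~ points_away x y x' -> points_away x y w ->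
  (points_away x' y' x <-> points_away x' y' w).
Proof.
move=> adj' nx' [p xp pw].
have xpT : path (@tree_adj G T) x p by move: (xp); apply: sub_path => a b /andP[].
split=> [px|pw']; apply: contrapT => npw; apply: nx';
    apply: (points_away_path xp).
  have npl : ~ points_away x' y' (last x p) by rewrite pw.
  by have [] := separating_edge_on_path xpT px npl.
have px : points_away y' x' x by apply/points_awayN.
have npl : ~ points_away y' x' (last x p) by rewrite pw; rewrite points_awayN // => /(_ pw').
by have [] := separating_edge_on_path xpT px npl.
Qed.

(** Whichever side of the first edge misses [x'] is connected, so it lies entirely on one side of
    the second edge. *)
Lemma sides_nested x y x' y' : tree_adj x y -> tree_adj x' y' ->
  [\/ forall w, points_away x y w -> ~ points_away x' y' w,
      forall w, points_away x y w -> points_away x' y' w,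
      forall w, ~ points_away x y w -> ~ points_away x' y' w
    | forall w, ~ points_away x y w -> points_away x' y' w].
Proof.
move=> xy xy'.
have yx : tree_adj y x by rewrite tree_adj_sym.
have [pp|npp] := pselect (points_away x y x').
  have H w : ~ points_away x y w -> points_away x' y' y <-> points_away x' y' w.
    move=> /(points_awayN _ xy) pyw; apply: (side_connected xy' _ pyw).
    by move=> pyx; case: ((points_awayN _ xy).1 pyx).
  have [p|np] := pselect (points_away x' y' y).
    by constructor 4 => w /H <-.
  by constructor 3 => w /H <-.
have H w : points_away x y w -> points_away x' y' x <-> points_away x' y' w.
  exact: side_connected.
have [p|np] := pselect (points_away x' y' x).
  by constructor 2 => w /H <-.
by constructor 1 => w /H <-.
Qed.

(** * The action on the tree and unboundedness of sides *)

Lemma tree_actK g : cancel (@tree_act G T g) (tree_act g^-1).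
Proof. by move=> x; rewrite -tree_actM mulVg tree_act1. Qed.

Lemma tree_actVK g : cancel (@tree_act G T g^-1) (tree_act g).
Proof. by move=> x; rewrite -tree_actM mulgV tree_act1. Qed.

Lemma points_away_act g x y w : points_away x y w ->
  points_away (tree_act g x) (tree_act g y) (tree_act g w).
Proof.
move=> [p xp <-]; exists (map (tree_act g) p); last by rewrite last_map.
apply: homo_path xp => a b.
rewrite /adj_minus /= tree_act_adj !xpair_eqE.
by rewrite !(can_eq (tree_actK g)).
Qed.

(* All edges being equivalent to [(u, u')], each has a leaf as an end: the tree
   is a single edge or a star, and the absence of inversions, respectively the
   centre of the star, yields a fixed vertex. *)
Lemma leaf_fixed_point u u' : @one_edge_orbit G T -> tree_adj u u' ->
  (forall z, tree_adj u z -> z = u') -> ~ @no_global_fixed_point G T.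
Proof.
move=> [_ orb] uu' leaf; apply.
pose is_leaf a := exists b, forall z, tree_adj a z -> z = b.
have leaf_act g a : is_leaf a -> is_leaf (tree_act g a).
  move=> [b ab]; exists (tree_act g b) => z.
  by rewrite -{1}[z](tree_actVK g) tree_act_adj => /ab <-; rewrite tree_actVK.
have edge_leaf a b : tree_adj a b -> is_leaf a \/ is_leaf b.
  move=> ab; have [g [[<- _]|[<- _]]] := orb _ _ _ _ uu' ab;
    [left|right]; by apply: leaf_act; exists u'.
have [[b leaf']|nleaf] := pselect (is_leaf u').
  have bu : b = u by apply/esym/leaf'; rewrite tree_adj_sym.
  have two w : w = u \/ w = u'.
    have walk (p : seq T) a : path (@tree_adj G T) a p -> a = u \/ a = u' ->
        last a p = u \/ last a p = u'.
      elim: p a => [|c p IH] a //= /andP[ac cp] E; apply: IH => //.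
      case: E => E; rewrite E in ac; [right|left]; first exact: leaf.
      by rewrite -bu; exact: leaf'.
    have [p up <-] := tree_connected u w.
    by apply: walk => //; left.
  exists u => g; have [//|guu'] := two (tree_act g u).
  have guadj : tree_adj (tree_act g u) (tree_act g u') by rewrite tree_act_adj.
  have [gu'u|gu'u'] := two (tree_act g u').
    by case: (tree_no_inversion uu' (conj guu' gu'u)).
  by move: guadj; rewrite guu' gu'u' tree_adj_irr.
pose star a := a = u' \/ is_leaf a /\ tree_adj a u'.
have walk (p : seq T) a : path (@tree_adj G T) a p -> star a -> star (last a p).
  elim: p a => [|c p IH] a //= /andP[ac cp] E; apply: IH => //.
  case: E => [E|[[b ab] au']]; last by left; rewrite (ab _ ac) -(ab _ au').
  rewrite E in ac; right; split; last by rewrite tree_adj_sym.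
  by case: (edge_leaf _ _ ac).
have star_all w : star w.
  have [p up <-] := tree_connected u' w.
  by apply: walk => //; left.
exists u' => g; have [//|[gleaf _]] := star_all (tree_act g u').
case: nleaf; rewrite -[u'](tree_actK g); exact: leaf_act.
Qed.

Lemma other_neighbour x y : @is_splitting G T -> tree_adj x y ->
  exists2 z, tree_adj x z & z <> y.
Proof.
move=> [nofix orb] xy; apply: contrapT => H.
apply: (leaf_fixed_point orb xy _ nofix) => z xz.
by apply: contrapT => zy; apply: H; exists z.
Qed.

(** The part of the tree beyond [z] misses [x], so the edge from [x] to [y] does not cut it; and [z]
    itself is joined to [x] by a different edge. *)
Lemma points_away_mono x y z w : tree_adj x z -> tree_adj x y -> z <> y ->
  points_away z x w -> points_away x y w.
Proof.
move=> xz xy zy pw.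
have zx : tree_adj z x by rewrite tree_adj_sym.
have pz : points_away x y z.
  apply: points_away_step (points_away_refl x y) _.
  rewrite /adj_minus /= xz !xpair_eqE eqxx /=; apply/andP; split; apply/negP.
    by move/eqP.
  by move=> /andP[/eqP xy']; move: xy; rewrite xy' tree_adj_irr.
suff : points_away x y z <-> points_away x y w by move=> <-.
apply: (side_connected xy _ pw); exact: not_points_away.
Qed.

Lemma edge_meets_orbit a b v : @is_splitting G T -> tree_adj a b ->
  exists g, tree_act g v = a \/ tree_act g v = b.
Proof.
move=> [nofix orb] ab.
have [z vz] : exists z, tree_adj v z.
  have [p] := tree_connected v a; case: p => [_ /= ->|c p /= /andP[vc _] _].
    by exists b.
  by exists c.
have [g [[ga _]|[gb _]]] := orb.2 _ _ _ _ vz ab; exists g; [by left|by right].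
Qed.

(** Induction on [n]: moving on to the edge from [z] to [x], with [z] another neighbour of [x],
    gains one step. *)
Lemma side_unbounded v n x y : @is_splitting G T -> tree_adj x y ->
  exists2 g, points_away x y (tree_act g v) &
    forall p : seq T, path (@tree_adj G T) y p -> last y p = tree_act g v ->
      n < size p.
Proof.
move=> spl; elim: n x y => [|n IH] x y xy.
all: have yx : tree_adj y x by rewrite tree_adj_sym.
all: have [z xz zy] := other_neighbour spl xy.
all: have zx : tree_adj z x by rewrite tree_adj_sym.
  have [g gv] := edge_meets_orbit v spl xz.
  have pg : points_away x y (tree_act g v).
    case: gv => ->; first exact: points_away_refl.
    by apply: (points_away_mono xz xy zy); exact: points_away_refl.
  exists g => // -[|//] _ /= gy.
  by case: (not_points_away xy); rewrite {2}gy.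
have [g pg far] := IH _ _ zx.
have pg' := points_away_mono xz xy zy pg.
exists g => // p yp pl.
have npl : ~ points_away y x (last y p) by rewrite pl points_awayN // => /(_ pg').
(* The path passes through [x] after leaving [y], and its tail from [x] already has more than [n]
   steps. *)
have [_] := separating_edge_on_path yp (points_away_refl y x) npl.
rewrite in_cons => /orP[/eqP xy'|xp].
  by move: xy; rewrite xy' tree_adj_irr.
case/splitPr: xp yp pl => p1 p2; rewrite cat_path last_cat /= => /and3P[_ _ xp2].
move=> /(far _ xp2) np2; rewrite size_cat /= addnS ltnS.
by rewrite (leq_trans np2) // leq_addl.
Qed.

End Tree.

(** * Translates, stabilizers and smallness *)

Section GroupSubsets.
Set Implicit Arguments.
Unset Strict Implicit.
Local Open Scope group_scope.
Variable G : groupType.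
Implicit Types (A B C X Y H K : set G) (g h k : G).

Lemma translateE g X : translate g X = [set x | X (g^-1 * x)].
Proof.
apply/seteqP; split=> [_ [x Xx <-]|x Xx] /=; first by rewrite mulKg.
by exists (g^-1 * x) => //; rewrite mulVKg.
Qed.

Lemma translateI g A B : translate g (A `&` B) = translate g A `&` translate g B.
Proof. by rewrite !translateE. Qed.

Lemma translateC g A : translate g (~` A) = ~` translate g A.
Proof. by rewrite !translateE. Qed.

Lemma translateM g h A : translate (g * h) A = translate g (translate h A).
Proof. by rewrite !translateE; apply/seteqP; split=> x; rewrite /= invgM mulgA. Qed.

Lemma translate1 A : translate 1 A = A.
Proof. by rewrite translateE invg1; apply/seteqP; split=> x; rewrite /= mul1g. Qed.

Lemma translateVK g A : translate g^-1 (translate g A) = A.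
Proof. by rewrite -translateM mulVg translate1. Qed.

Lemma stab_mem A h x : stab A h -> A (h * x) <-> A x.
Proof. by rewrite /stab /= => {1}<-; rewrite translateE /= mulKg. Qed.

Lemma stabV A h : stab A h -> stab A h^-1.
Proof. by rewrite /stab /= => {1}<-; rewrite translateVK. Qed.

Lemma stab_setC A : stab (~` A) = stab A.
Proof.
apply/seteqP; rewrite /stab; split=> h /=; rewrite translateC; last by move=> ->.
by move=> hA; rewrite -[LHS]setCK hA setCK.
Qed.

Lemma stab_translate g A h : stab A h -> stab (translate g A) (g * h * g^-1).
Proof. by rewrite /stab /= => hA; rewrite -translateM mulgVK translateM hA. Qed.

Lemma finite_mod_sub H Y X : X `<=` Y -> finite_mod H Y -> finite_mod H X.
Proof. by move=> XY [F finF YF]; exists F => // x /XY /YF. Qed.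

Lemma finite_mod_empty H X : (forall g, ~ X g) -> finite_mod H X.
Proof. by move=> X0; exists set0 => // x /X0. Qed.

Lemma finite_mod_bigcup (I : Type) (D : set I) (Y : I -> set G) H :
  finite_set D -> (forall i, D i -> finite_mod H (Y i)) ->
  finite_mod H (\bigcup_(i in D) Y i).
Proof.
move=> finD HY.
have /choice[F HF] (i : I) : exists F : set G, D i ->
    finite_set F /\ Y i `<=` \bigcup_(g in F) rcoset_of H g.
  have [/HY[F ? ?]|] := pselect (D i); first by exists F.
  by exists set0.
exists (\bigcup_(i in D) F i).
  by apply: bigcup_finite => // i /HF[].
move=> x [i Di Yx]; have [_ YF] := HF i Di; have [g Fg gx] := YF x Yx.
by exists g => //; exists i.
Qed.

Lemma small_setC A C : small (~` A) C = small A C.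
Proof. by rewrite /small stab_setC. Qed.

(** Since [g H f = (g H g^-1) (g f)], right cosets of the stabilizer of [A] go to right cosets of
    its conjugate. *)
Lemma small_translate g A C : small A C -> small (translate g A) (translate g C).
Proof.
move=> [F finF CF]; exists [set g * x | x in F]; first exact: finite_image.
move=> _ [x /CF [f Ff [h hA <-]] <-]; exists (g * f); first by exists f.
exists (g * h * g^-1); first exact: stab_translate.
by rewrite !mulgA mulgVK.
Qed.

Lemma small_translateE g A C :
  small (translate g A) (translate g C) <-> small A C.
Proof.
split=> [/(small_translate g^-1)|]; last exact: small_translate.
by rewrite !translateVK.
Qed.

Lemma ai_le_translate g A B : ai_le A B -> ai_le (translate g A) (translate g B).
Proof.
case=> [AB0|[s1 s2 s3 s4]].
  by left; rewrite -translateC -translateI AB0 /translate image_set0.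
by right; split; rewrite -?translateC -translateI small_translateE.
Qed.

Lemma ai_le_small A B : ai_le A B -> small A (A `&` ~` B).
Proof. by case=> [->|[]//]; apply: finite_mod_empty => g []. Qed.

Lemma crosses_not_ai_le A B : crosses A B -> ~ ai_le A B.
Proof. by move=> [_ + _ _] /ai_le_small. Qed.

Lemma crosses_not_ai_leC A B : crosses A B -> ~ ai_le (~` A) B.
Proof. by move=> [_ _ _ +] /ai_le_small; rewrite small_setC. Qed.

Lemma Sigma_refl X : Sigma X X.
Proof. by exists 1; left; rewrite translate1. Qed.

Lemma Sigma_setC X A : Sigma X A -> Sigma X (~` A).
Proof.
by move=> [g [->|->]]; exists g; rewrite -translateC ?setCK; [right|left].
Qed.

Lemma Sigma_translate g X A : Sigma X A -> Sigma X (translate g A).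
Proof.
by move=> [h [->|->]]; exists (g * h); rewrite !translateM; [left|right].
Qed.

End GroupSubsets.

(** * Half-spaces and the duality of the order *)

Section HalfSpaces.
Set Implicit Arguments.
Unset Strict Implicit.
Local Open Scope group_scope.
Variable G : groupType.
Implicit Types (A B C X : set G) (T : gtree G).

Definition halfspace T (v a b : T) : set G :=
  [set g | points_away a b (tree_act g v)].

Lemma halfspaceC T (v a b : T) : tree_adj a b ->
  ~` halfspace v a b = halfspace v b a.
Proof.
move=> ab; apply/seteqP; split=> g.
  by move=> ?; apply: (points_awayN _ ab).2.
by move=> /(points_awayN _ ab).1.
Qed.

Lemma translate_halfspace T (v a b : T) g :
  translate g (halfspace v a b) = halfspace v (tree_act g a) (tree_act g b).
Proof.
rewrite translateE; apply/seteqP; split=> h; rewrite /halfspace /= tree_actM.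
  by move/(points_away_act g); rewrite tree_actVK.
by move/(points_away_act g^-1); rewrite !tree_actK.
Qed.

Lemma edge_stab_halfspace T (v a b : T) :
  edge_stab a b `<=` stab (halfspace v a b).
Proof. by move=> g [ga gb]; rewrite /stab /= translate_halfspace ga gb. Qed.

(** Both ends of a separating edge lie on one fixed path from [a] to [b]. *)
Lemma finite_separating T (a b : T) :
  finite_set [set e : T * T | [/\ tree_adj e.1 e.2, points_away e.1 e.2 a
                                & ~ points_away e.1 e.2 b]].
Proof.
have [p ap pb] := tree_connected a b.
apply: (@sub_finite_set _ _ ([set` a :: p] `*` [set` a :: p])).
  move=> [x y] /= [_ xa yb]; rewrite -pb in yb.
  exact: (separating_edge_on_path ap xa yb).
by apply: finite_setX; exact: finite_seq.
Qed.

(* A path from the far end of the edge to [g v] is carried by the stabilizer of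
   the edge to one of the same length, so finitely many cosets stay at bounded
   distance from the edge. *)
Lemma halfspace_not_small T (v a b : T) : is_splitting T -> tree_adj a b ->
  ~ finite_mod (edge_stab a b) (halfspace v a b).
Proof.
move=> spl ab [F /finite_seqP[s ->] XF].
pose near n g := exists2 p : seq T, path (@tree_adj G T) b p &
   last b p = tree_act g v /\ size p <= n.
have [n nearn] : exists n, forall g, g \in s -> near n g.
  elim: s {XF} => [|g s [n IH]]; first by exists 0.
  have [p bp pv] := tree_connected b (tree_act g v).
  exists (maxn n (size p)) => h; rewrite in_cons => /orP[/eqP->|/IH].
    by exists p => //; rewrite leq_maxr.
  by move=> [q bq [qv qn]]; exists q => //; rewrite leq_max qn.
have [g Xg far] := side_unbounded v n spl ab.
have [f /= /nearn[p bp [pv pn]] [h [ha hb] hfg]] := XF _ Xg.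
suff : n < size (map (tree_act h) p) by rewrite size_map ltnNge pn.
apply: far.
  rewrite -[X in path _ X]hb; apply: homo_path bp => x y.
  by rewrite tree_act_adj.
by rewrite -[X in last X]hb last_map pv -tree_actM hfg.
Qed.

(* Take [x] in [A] outside the finitely many cosets [stab A * g] covering the
   corner. Then [stab A * x] avoids the half-space, so for [h] in [stab A] with
   [h * g] in the half-space the edge [h^-1 (a, b)] separates [g v] from [x v]:
   finitely many edges, hence finitely many cosets of the edge stabilizer. *)
Lemma small_halfspace A T (v a b : T) : tree_adj a b -> ~ small A A ->
  small A (A `&` halfspace v a b) ->
  small (halfspace v a b) (A `&` halfspace v a b).
Proof.
set C := halfspace v a b => ab nAA [F finF ACF].
have [x Ax xF] : exists2 x, A x & ~ (\bigcup_(g in F) rcoset_of (stab A) g) x.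
  apply: contrapT => H; apply: nAA; exists F => // x Ax.
  by apply: contrapT => xF; apply: H; exists x.
pose S g := [set e : T * T | [/\ tree_adj e.1 e.2,
  points_away e.1 e.2 (tree_act g v) & ~ points_away e.1 e.2 (tree_act x v)]].
pose Y g (e : T * T) := [set y | exists h,
  [/\ y = h * g, tree_act h e.1 = a & tree_act h e.2 = b]].
apply: (@finite_mod_sub _ _ (\bigcup_(g in F) \bigcup_(e in S g) Y g e)).
  move=> y [Ay Cy]; have [g Fg [h hA hgy]] := ACF y (conj Ay Cy).
  exists g => //; exists (tree_act h^-1 a, tree_act h^-1 b); last first.
    by exists h; rewrite /= !tree_actVK.
  split=> /=; first by rewrite tree_act_adj.
    by move: Cy => /(points_away_act h^-1); rewrite -tree_actM -hgy mulKg.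
  move/(points_away_act h); rewrite !tree_actVK -tree_actM => Chx.
  have Ahx : A (h * x) by rewrite (stab_mem _ hA).
  have [k Fk [h' h'A h'k]] := ACF _ (conj Ahx Chx).
  apply: xF; exists k => //; exists (h^-1 * h'); last by rewrite -mulgA h'k mulKg.
  by rewrite /stab /= translateM h'A; exact: (stabV hA).
apply: finite_mod_bigcup => // g _; apply: finite_mod_bigcup => [|e _].
  exact: finite_separating.
(* Two elements carrying [e] to [(a, b)] differ by a left factor fixing that edge, so [Y g e] lies
   in a single coset. *)
have [[h [ha hb]]|nh] :=
  pselect (exists h, tree_act h e.1 = a /\ tree_act h e.2 = b).
  exists [set h * g]; first exact: finite_set1.
  move=> _ [k [-> ka kb]]; exists (h * g) => //; exists (k * h^-1).
    apply: edge_stab_halfspace; rewrite -ha -hb.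
    by split; rewrite tree_actM tree_actK ?ha ?hb.
  by rewrite mulgA mulgVK.
by apply: finite_mod_empty => y [h [_ ha hb]]; apply: nh; exists h.
Qed.

(** The tree is quantified so that half-spaces of different splittings can be compared. The reverse
    inclusion of stabilizers is [edge_stab_halfspace]. *)
Definition is_halfspace C := exists (T : gtree G) (v a b : T),
  [/\ is_splitting T, tree_adj a b, stab C `<=` edge_stab a b
    & C = halfspace v a b].

Lemma is_halfspaceC C : is_halfspace C -> is_halfspace (~` C).
Proof.
move=> [T [v [a [b [spl ab st CE]]]]]; exists T, v, b, a.
rewrite tree_adj_sym stab_setC; split=> //; last by rewrite CE halfspaceC.
by move=> g /st [ga gb].
Qed.

Lemma is_halfspace_not_small C : is_halfspace C -> ~ small C C.
Proof.
move=> [T [v [a [b [spl ab st CE]]]]] [F finF CF].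
apply: (@halfspace_not_small T v a b spl ab); rewrite -CE; exists F => //.
by move=> x /CF [g Fg [h /st hst hgx]]; exists g => //; exists h.
Qed.

Lemma small_cornerC A B : is_halfspace A -> is_halfspace B ->
  small A (A `&` B) <-> small B (A `&` B).
Proof.
suff H A' B' : is_halfspace A' -> is_halfspace B' ->
    small A' (A' `&` B') -> small B' (A' `&` B').
  by move=> hA hB; split; [|rewrite ![A `&` B]setIC]; exact: H.
move=> /is_halfspace_not_small nsA [T [v [a [b [_ ab _ ->]]]]].
exact: small_halfspace.
Qed.

(** Both pairs have the same four corners, with the distinguished one unchanged; [small_cornerC]
    switches the stabilizer. *)
Lemma ai_le_setC A B : is_halfspace A -> is_halfspace B ->
  ai_le A B -> ai_le (~` B) (~` A).
Proof.
move=> hA hB.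
have [hA' hB'] := (is_halfspaceC hA, is_halfspaceC hB).
case=> [AB0|[s1 s2 s3 s4]]; first by left; rewrite setCK setIC.
right; rewrite !setCK !small_setC; split; rewrite setIC.
- by rewrite -small_setC -small_cornerC.
- by rewrite -small_setC -small_cornerC // small_setC.
- by rewrite -small_cornerC // small_setC.
- by rewrite -small_cornerC.
Qed.

(** Nestedness makes some corner empty, hence small; by the definition of the order it can only be
    the one expressing inclusion. *)
Lemma ai_le_same_tree T (v a b a' b' : T) :
  tree_adj a b -> tree_adj a' b' ->
  ai_le (halfspace v a b) (halfspace v a' b') ->
  halfspace v a b `<=` halfspace v a' b'.
Proof.
move=> ab ab' [/disjoints_subset|[_ s2 s3 s4]]; first by rewrite setCK.
have [H|H|H|H] := sides_nested ab ab'.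
- by case: s2; apply: finite_mod_empty => g [/H].
- by move=> g /H.
- by case: s3; apply: finite_mod_empty => g [/H].
- by case: s4; apply: finite_mod_empty => g [/H].
Qed.

End HalfSpaces.

(** * Finiteness of intervals *)

Section Intervals.
Set Implicit Arguments.
Unset Strict Implicit.
Local Open Scope group_scope.
Variable G : groupType.
Implicit Types (A B C X Y : set G) (T : gtree G).

(** Translates move the edge and complements reverse it, so one base vertex [v] serves all of
    [Sigma X]. *)
Lemma Sigma_halfspace T (H X : set G) : arises_from T H X ->
  exists v : T, forall C, Sigma X C -> exists a b : T,
    [/\ tree_adj a b, stab C `<=` edge_stab a b & C = halfspace v a b].
Proof.
move=> [v [x [y [xy XE HE HX]]]]; exists v.
have edge_stab_act g (a b : T) C : stab C `<=` edge_stab a b ->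
    stab (translate g C) `<=` edge_stab (tree_act g a) (tree_act g b).
  move=> st h /(stab_translate g^-1); rewrite translateVK invgK => /st [].
  rewrite !tree_actM => ha hb.
  by split; rewrite -[LHS](tree_actVK g) ?ha ?hb.
have stX : stab X `<=` edge_stab x y by rewrite -HX HE.
have stXC : stab (~` X) `<=` edge_stab y x by rewrite stab_setC => g /stX [].
have yx : tree_adj y x by rewrite tree_adj_sym.
move=> C [g [->|->]].
  exists (tree_act g x), (tree_act g y); rewrite tree_act_adj; split=> //.
    exact: edge_stab_act.
  by rewrite XE -translate_halfspace.
exists (tree_act g y), (tree_act g x); rewrite tree_act_adj; split=> //.
  exact: edge_stab_act.
by rewrite -translate_halfspace -halfspaceC // XE.
Qed.

Lemma Sigma_is_halfspace T (H X C : set G) : is_splitting T ->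
  arises_from T H X -> Sigma X C -> is_halfspace C.
Proof.
move=> spl /Sigma_halfspace[v HC] /HC[a [b [ab st CE]]].
by exists T, v, a, b.
Qed.

Lemma finite_interval_same_tree T (H X A B : set G) : is_splitting T ->
  arises_from T H X -> Sigma X A -> Sigma X B ->
  finite_set [set C | [/\ Sigma X C, ai_le A C & ai_le C B]].
Proof.
move=> spl arX SA SB.
have /is_halfspace_not_small nA := Sigma_is_halfspace spl arX SA.
have /is_halfspace_not_small nB :=
  Sigma_is_halfspace spl arX (Sigma_setC SB).
have [x Ax] : exists x, A x.
  apply: contrapT => A0; apply/nA/finite_mod_empty => g Ag.
  by apply: A0; exists g.
have [y By] : exists y, ~ B y.
  apply: contrapT => B0; apply/nB/finite_mod_empty => g Bg.
  by apply: B0; exists g.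
have [v HS] := Sigma_halfspace arX.
have := finite_separating (tree_act x v) (tree_act y v).
move=> /(finite_image (fun e => halfspace v e.1 e.2)).
apply: sub_finite_set => C [SC AC CB].
have [a [b [ab _ AE]]] := HS _ SA.
have [a' [b' [ab' _ BE]]] := HS _ SB.
have [c [d [cd _ CE]]] := HS _ SC.
(* Both comparisons are inclusions, so [C] contains [x] and misses [y]. *)
exists (c, d) => //; split=> //=.
  move: Ax AC; rewrite AE CE => Ax AC; exact: (ai_le_same_tree ab cd AC).
move: By CB; rewrite BE CE => By CB Cy; apply: By.
exact: (ai_le_same_tree cd ab' CB).
Qed.

(** The comparison with [C], translated back to [X] or its complement, rules out crossing. The
    sandwich of [X] is then translated to [A], and dualized first if [A] comes from the
    complement. *)
Lemma sandwiched_lower X Y A C : is_halfspace X ->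
  (forall B, Sigma Y B -> is_halfspace B) -> sandwiched X Y ->
  Sigma X A -> Sigma Y C -> ai_le A C -> exists2 D, Sigma Y D & ai_le D A.
Proof.
move=> hX hY sw [g AE] SC AC.
case: sw => [[P [Q [SP SQ PX XQ]]]|cross].
  case: AE => ->; first by exists (translate g P);
    [exact: Sigma_translate|exact: ai_le_translate].
  exists (translate g (~` Q)); first exact/Sigma_translate/Sigma_setC.
  by apply: ai_le_translate; apply: ai_le_setC => //; exact: hY.
have := cross _ (Sigma_translate g^-1 SC); have := ai_le_translate g^-1 AC.
case: AE => ->; rewrite translateVK => le cr.
  by case: (crosses_not_ai_le cr le).
by case: (crosses_not_ai_leC cr le).
Qed.

End Intervals.

Theorem proposition7p4 (G : groupType) (n : nat)
    (sigma : 'I_n -> gtree G) (H X : 'I_n -> set G)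
    (sigma_splitting : forall j : 'I_n, splitting_over (sigma j) (H j))
    (X_arises : forall j : 'I_n, arises_from (sigma j) (H j) (X j))
    (le_order : partial_order_on (Sigma_family X) (@ai_le G))
    (X_sandwiching : sandwiching X)
    (A B : set G) (SA : Sigma_family X A) (SB : Sigma_family X B) :
  finite_set [set C : set G | [/\ Sigma_family X C, ai_le A C & ai_le C B]].
Proof.
have [_ _ le_trans] := le_order.
have spl j : is_splitting (sigma j) by case: (sigma_splitting j).
have half j C : Sigma (X j) C -> is_halfspace C.
  exact: (Sigma_is_halfspace (spl j) (X_arises j)).
have halfX j : is_halfspace (X j) by apply: (half j); exact: Sigma_refl.
have inS j C : Sigma (X j) C -> Sigma_family X C by exists j.
have [[j _ SjA] [l _ SlB]] := (SA, SB).
apply: (@sub_finite_set _ _ (\bigcup_(k in [set: 'I_n])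
    [set C | [/\ Sigma (X k) C, ai_le A C & ai_le C B]])).
  by move=> C [[k _ SkC] AC CB]; exists k.
apply: bigcup_finite; first exact: finite_finset.
move=> k _.
have [[C0 [SC0 AC0 C0B]]|none] :=
  pselect (exists C, [/\ Sigma (X k) C, ai_le A C & ai_le C B]); last first.
  by apply: (@sub_finite_set _ _ set0) => // C HC; case: none; exists C.
have [P SP PA] :=
  sandwiched_lower (halfX j) (half k) (X_sandwiching j k) SjA SC0 AC0.
(* The upper bound is obtained as a lower bound [Q] for the complement of [B], which lies below that
   of [C0]. *)
have [Q SQ QB] := sandwiched_lower (halfX l) (half k) (X_sandwiching l k)
  (Sigma_setC SlB) (Sigma_setC SC0) (ai_le_setC (half k _ SC0) (half l _ SlB) C0B).
have BQ : ai_le B (~` Q).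
  rewrite -[B]setCK; apply: ai_le_setC QB; first exact: half SQ.
  exact: half (Sigma_setC SlB).
have SQ' := Sigma_setC SQ.
apply: sub_finite_set
  (finite_interval_same_tree (spl k) (X_arises k) SP SQ') => C [SC AC CB].
split=> //; first exact: le_trans (inS _ _ SP) SA (inS _ _ SC) PA AC.
exact: le_trans (inS _ _ SC) SB (inS _ _ SQ') CB BQ.
Qed.
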